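(* Let $K\in\mathbb N\cup\{\infty\}$ and consider a fixed realization $\{D_i\}$ of jump times, coupled labeled-particle processes $z(t)$ and $\tilde z(t)$, the auxiliary processes $\xi^k(t)$, $k\in\mathbb Z$, and the second class particle position $X(t)$, all as described in the context. Then for every $t\ge0$, $$X(t)=\inf\{i\in\mathbb Z:\ z(i,t)=z(k,0)-\xi^k(i-k,t)\ \text{for some}\ k\ge X(0)\}$$ and $$X(t)=1+\sup\{i\in\mathbb Z:\ \tilde z(i,t)=\tilde z(k,0)-\xi^k(i-k,t)\ \text{for some}\ k<X(0)\}.$$
   Context: Jump times. For each $i\in\mathbb Z$, $D_i\subset(0,\infty)$ is a set of jump times (epochs) (a realization of independent rate 1 Poisson point processes) such that: no two different $D_i$ share an epoch; each $D_i$ has finitely many epochs in each bounded time interval; and for every $t_1>0$ there are indices $i_0<0<i_1$ with $|i_0|,|i_1|$ arbitrarily large such that $D_{i_0}$ and $D_{i_1}$ have no epochs in $[0,t_1]$. (These hold almost surely.) Process $z$. $z(t)=(z(i,t):i\in\mathbb Z)$ is integer-valued with $0\le z(i+1,t)-z(i,t)\le K$ for all $i$ (no upper bound if $K=\infty$). Starting from an initial configuration $z(\cdot,0)$ with this property, it evolves only as follows: at each epoch $t$ of $D_i$, $z(i,t)=\max\{z(i,t-)-1,\ z(i-1,t-),\ z(i+1,t-)-K\}$ (last term omitted if $K=\infty$). The increments $\eta(i,t)=z(i,t)-z(i-1,t)$ form the totally asymmetric $K$-exclusion process. Second class particle. $X(0)\in\mathbb Z$ satisfies $\eta(X(0),0)\le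 K-1$. The process $\tilde z$ evolves by the same rules with the same $\{D_i\}$ from the initial configuration $\tilde z(i,0)=z(i,0)$ for $i\le X(0)-1$ and $\tilde z(i,0)=z(i,0)+1$ for $i\ge X(0)$. For each $t\ge0$ there is a unique finite $X(t)\in\mathbb Z$ such that $\tilde z(i,t)=z(i,t)$ for $i\le X(t)-1$ and $\tilde z(i,t)=z(i,t)+1$ for $i\ge X(t)$; this is the position of the second class particle. Auxiliary processes. For $k\in\mathbb Z$, $\xi^k(i,0)=0$ for $i\ge0$ and $\xi^k(i,0)=-Ki$ for $i<0$ ($=+\infty$ if $K=\infty$); at each epoch $t$ of $D_{i+k}$, $\xi^k(i,t)=\min\{\xi^k(i,t-)+1,\ \xi^k(i-1,t-),\ \xi^k(i+1,t-)+K\}$ (last term omitted if $K=\infty$), with no other changes. It is known that $z(i,t)=\sup_{k\in\mathbb Z}\{z(k,0)-\xi^k(i-k,t)\}$ for all $i\in\mathbb Z$, $t\ge0$, for every integer-valued process $z$ that starts from an initial configuration with $0\le z(i+1,0)-z(i,0)\le K$ for all $i$ (no upper bound if $K=\infty$) and evolves only by the rule that at each epoch $t$ of $D_i$, $z(i,t)=\max\{z(i,t-)-1,\ z(i-1,t-),\ z(i+1,t-)-K\}$ (last term omitted if $K=\infty$) (in particular also for $\tilde z$), the supremum being attained. *)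

(* Defs.v *)
From HB Require Import structures.
From mathcomp Require Import all_boot all_order all_algebra.
From mathcomp Require Import boolp classical_sets functions cardinality.
From mathcomp Require Import set_interval reals ereal topology normedtype.

Set Implicit Arguments.
Unset Strict Implicit.
Unset Printing Implicit Defensive.

Import Order.TTheory GRing.Theory Num.Theory.

Local Open Scope classical_set_scope.
Local Open Scope ring_scope.

(* Throughout, K : option nat encodes an element of N with infinity adjoined:
   Some n is the integer n and None is infinity. *)

Record jump_times (R : realType) (D : int -> set R) : Prop := JumpTimes {
  jump_times_gt0 : forall i t, D i t -> 0 < t;
  jump_times_disjoint : forall (i j : int) (t : R), i != j -> D i t -> ~ D j t;
  jump_times_locally_finite : forall i a b, finite_set (D i `&` `[a, b]);
  jump_times_blocks : forall t1 : R, 0 < t1 -> forall n : nat,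
    exists i0 i1 : int,
      [/\ i0 < 0 < i1, n%:Z <= `|i0| /\ n%:Z <= `|i1|,
          D i0 `&` `[0, t1] = set0 & D i1 `&` `[0, t1] = set0]
}.

(* The states involved are discrete, so the left limit f(t-) is the value that
   f takes at all times sufficiently close to t on the left. *)
Definition left_value (R : realType) (T : Type) (f : R -> T) (t : R) (v : T) :=
  \forall u \near t^'-, f u = v.

(* w evolves, on the time interval [0, +oo[, only by the rule that at each epoch
   t of D i, w i t = F (w (i-1) t-) (w i t-) (w (i+1) t-).
   The values of w at negative times are irrelevant. *)
Record evolves (R : realType) (T : Type) (D : int -> set R)
    (F : T -> T -> T -> T) (w : int -> R -> T) : Prop := Evolves {
  evolves_jump : forall i t, D i t -> exists l c r : T,
    [/\ left_value (w (i - 1)) t l, left_value (w i) t c,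
        left_value (w (i + 1)) t r & w i t = F l c r];
  evolves_constant : forall i (s t : R), 0 <= s -> s <= t ->
    D i `&` `]s, t] = set0 -> w i t = w i s
}.

Definition admissible (K : option nat) (w : int -> int) : Prop :=
  forall i : int, 0 <= w (i + 1) - w i /\
    (if K is Some n then w (i + 1) - w i <= n%:Z else True).

Definition z_rule (K : option nat) (l c r : int) : int :=
  let m := Num.max (c - 1) l in
  if K is Some n then Num.max m (r - n%:Z) else m.

Definition eta (R : realType) (z : int -> R -> int) (i : int) (t : R) : int :=
  z i t - z (i - 1) t.

Definition second_class_start (R : realType) (K : option nat)
    (z : int -> R -> int) (x : int) : Prop :=
  if K is Some n then eta z x 0 <= n%:Z - 1 else True.

(* For t = 0 this prescribes the initial configuration of the process zt in
   terms of the one of z and of X(0); for t > 0 it determines X(t) uniquely. *)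
Definition second_class_position (R : realType) (z zt : int -> R -> int)
    (t : R) (x : int) : Prop :=
  (forall i, i <= x - 1 -> zt i t = z i t) /\
  (forall i, x <= i -> zt i t = z i t + 1).

Definition xi_init (K : option nat) (i : int) : \bar int :=
  if 0 <= i then 0%:E
  else if K is Some n then (- (n%:Z * i))%:E else +oo%E.

Definition xi_rule (K : option nat) (l c r : \bar int) : \bar int :=
  let m := Order.min (c + 1%:E)%E l in
  if K is Some n then Order.min m (r + n%:Z%:E)%E else m.

Record auxiliary (R : realType) (K : option nat) (D : int -> set R) (k : int)
    (xi : int -> R -> \bar int) : Prop := Auxiliary {
  auxiliary_init : forall i, xi i 0 = xi_init K i;
  auxiliary_evolves : evolves (fun i => D (i + k)) (xi_rule K) xi
}.

(* Main.v *)
(* By max-plus linearity, the dynamics of z propagates the variational formula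
   z(i,t) = max_k (z(k,0) - xi^k(i-k,t)) from one epoch to the next; since the
   sites without epochs up to t confine the dynamics to finite blocks, an
   induction on the number of epochs of a block yields it at all times.  The
   formulas for X(t) follow by comparing the maximizers k of z and zt: the two
   initial configurations differ by 1 exactly when k >= X(0), and the two
   configurations at time t differ by 1 exactly when i >= X(t). *)
Require Import Defs.
From HB Require Import structures.
From mathcomp Require Import all_boot all_order all_algebra.
From mathcomp Require Import boolp classical_sets functions cardinality.
From mathcomp Require Import set_interval reals ereal topology normedtype.
From mathcomp Require Import zify lra.

Set Implicit Arguments.
Unset Strict Implicit.
Unset Printing Implicit Defensive.

Import Order.TTheory GRing.Theory Num.Theory.

Local Open Scope classical_set_scope.
Local Open Scope ring_scope.

(** * Finite sets and counting *)

Lemma finite_set_max d (T : orderType d) (A : set T) :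
  finite_set A -> A !=set0 -> exists2 m, A m & forall x, A x -> (x <= m)%O.
Proof.
move=> /finite_seqP[s ->]; elim: s => [[x //]|a [|b s] IH _].
  by exists a => [|x] /=; rewrite inE // => /eqP ->.
have [|m /= ms lem] := IH; first by exists b; rewrite /= mem_head.
exists (Order.max a m) => /= [|x].
  by case: leP => _; rewrite in_cons ?ms ?orbT // eqxx.
rewrite in_cons => /predU1P[->|/lem xm]; first by rewrite le_max lexx.
by rewrite le_max xm orbT.
Qed.

(** The element [y] itself is counted on the right only. This supplies the decreasing measure for
    the induction on epochs. *)
Lemma count_lt d (T : porderType d) (s : seq T) x y :
  (x < y)%O -> y \in s -> (count (<= x)%O s < count (<= y)%O s)%N.
Proof.
move=> xy ys; have := count_predUI (<= x)%O (pred1 y) s.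
rewrite (eq_count (a1 := predI _ _) (a2 := pred0)) ?count_pred0 ?addn0 => [e|z /=]; last first.
  by apply/negP => /andP[zx /eqP zy]; move: xy; rewrite -zy => /lt_geF; rewrite zx.
apply: leq_trans (_ : count (predU (<= x)%O (pred1 y)) s <= _)%N.
  by rewrite e -addn1 leq_add2l -has_count has_pred1.
by apply: sub_count => z /= /orP[/le_trans|/eqP -> //]; apply; exact: ltW.
Qed.

Lemma finite_set_itv_int (a b : int) : finite_set [set i | a <= i <= b].
Proof.
apply: (sub_finite_set (B := (fun m : nat => a + m%:Z) @` `I_(`|b - a|.+1))).
  by move=> i /= /andP[ai ib]; exists `|i - a|%N; lia.
exact/finite_image/finite_II.
Qed.

(** * Processes driven by the jump times *)

Section evolution.
Context {R : realType} {D : int -> set R}.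

(** Recentring at [k] makes every auxiliary process jump at the same epochs of [D] as the height
    process. *)
Lemma evolves_shift (T : Type) (F : T -> T -> T -> T) w k :
  evolves (fun i => D (i + k)) F w -> evolves D F (fun i => w (i - k)).
Proof.
move=> [jump const]; split=> [i t Dit|i s t s0 st].
  have := jump (i - k) t; rewrite subrK => /(_ Dit) [l [c [r [hl hc hr e]]]].
  by exists l, c, r; rewrite (addrAC i (-1)) (addrAC i 1); split.
by move=> Dst; apply: const => //; rewrite subrK.
Qed.

Hypothesis hD : jump_times D.

(* The witness u does not depend on the process w, which allows the maximizer k
   found at time u to be used at time t. *)
Lemma evolves_step i t : D i t -> exists2 u : R, 0 <= u < t &
  forall (T : Type) (F : T -> T -> T -> T) w, evolves D F w ->
    w i t = F (w (i - 1) u) (w i u) (w (i + 1) u).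
Proof.
move=> Dit; have t0 := jump_times_gt0 hD Dit.
(* The witness is the last epoch before [t] among the sites [i - 1], [i], [i + 1], or 0 if there is
   none; these sites keep their values from then until just before [t]. *)
pose U := D (i - 1) `|` D i `|` D (i + 1).
pose A := [set 0] `|` (U `&` [set s | 0 <= s < t]).
have finA : finite_set A.
  rewrite finite_setU; split; first exact: finite_set1.
  apply: (@sub_finite_set _ _ (U `&` `[0, t])).
    by apply: setIS => s /= /andP[s0 st]; rewrite in_itv /= s0 ltW.
  by rewrite !setIUl !finite_setU; do ![split]; apply: jump_times_locally_finite hD _ _ _.
have [|u Au maxu] := finite_set_max finA; first by exists 0; left.
have /andP[u0 ut] : 0 <= u < t by case: Au => [->|[_]] //; rewrite lexx t0.
exists u; first by rewrite u0 ut.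
move=> T F w [jump const].
have leftE j v : D j `<=` U -> left_value (w j) t v -> v = w j u.
  move=> DU hv.
  have : \forall x \near t^'-, [/\ w j x = v, u < x & x < t].
    near=> x; split; [by near: x|by near: x; exact: nbhs_left_gt|].
    by near: x; exact: nbhs_left_lt.
  move=> /(@filter_ex _ t^'-) [x [<- ux xt]].
  apply: const => //; first exact: ltW.
  rewrite -subset0 => y [Djy] /=; rewrite in_itv /= => /andP[uy yx].
  have : y <= u by apply: maxu; right; split; [exact: DU|apply/andP; split; lra].
  by rewrite leNgt uy.
have [l [c [r [hl hc hr ->]]]] := jump i t Dit.
rewrite (leftE _ _ _ hl) ?(leftE _ _ _ hc) ?(leftE _ _ _ hr) //.
- by move=> x Dx; right.
- by move=> x Dx; left; right.
- by move=> x Dx; left; left.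
Unshelve. all: by end_near.
Qed.

(* Epochs cannot be listed in increasing order along the whole of int: the
   induction is on the number of epochs of a block of sites whose two end sites
   have no epochs. *)
Lemma evolution_ind (P : int -> R -> Prop) :
  (forall i, P i 0) ->
  (forall i (s t : R), 0 <= s -> s <= t -> D i `&` `]s, t] = set0 -> P i s -> P i t) ->
  (forall i t, D i t -> exists2 u : R, 0 <= u < t &
     P (i - 1) u -> P i u -> P (i + 1) u -> P i t) ->
  forall i (t : R), 0 <= t -> P i t.
Proof.
move=> P0 Pconst Pstep i t t0.
(* The horizon [t + 1] is positive even for [t = 0], and the distance [|i|.+1] places [i] inside the
   block. *)
have t10 : 0 < t + 1 by rewrite ltr_wpDl.
have [i0 [i1 [i01 [le0 le1] D0 D1]]] := jump_times_blocks hD t10 `|i|.+1.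
pose E := \bigcup_(j in [set j | i0 <= j <= i1]) (D j `&` `[0, t + 1]).
have /finite_seqP[es Ees] : finite_set E.
  apply: bigcup_finite => [|j _]; first exact: finite_set_itv_int.
  exact: jump_times_locally_finite hD _ _ _.
suff block n s j : (count (<= s) es < n)%N -> 0 <= s <= t + 1 ->
    i0 <= j <= i1 -> P j s.
  apply: (block (count (<= t) es).+1) => //; first by apply/andP; split; lra.
  lia.
elim: n s j => // n IH s j ltn /andP[s0 st] /andP[j0 j1].
have [A0|/set0P An0] := eqVneq (D j `&` `[0, s]) set0.
  apply: (Pconst _ 0) => //; rewrite -subset0 -A0; apply: setIS => x /=.
  by rewrite !in_itv /= => /andP[/ltW -> ->].
(* Only the last epoch [tau] of site [j] up to [s] matters: the value at [j] stays constant from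
   [tau] to [s]. *)
have [tau [Dtau]] := finite_set_max (jump_times_locally_finite hD j 0 s) An0.
rewrite /= in_itv /= => /andP[tau0 taus] maxtau.
apply: (Pconst _ tau) => //.
  rewrite -subset0 => x [Dx] /=; rewrite in_itv /= => /andP[taux xs].
  have : x <= tau.
    by apply: maxtau; split=> //; rewrite /= in_itv /= xs (le_trans tau0 (ltW taux)).
  by rewrite leNgt taux.
have taut : 0 <= tau <= t + 1 by rewrite tau0 (le_trans taus).
(* A site with an epoch is not an end of the block, so both its neighbours still lie in the
   block. *)
have i0j : i0 != j.
  by apply: contra_eqN D0 => /eqP ->; apply/set0P; exists tau; split.
have i1j : i1 != j.
  by apply: contra_eqN D1 => /eqP ->; apply/set0P; exists tau; split.
have [u /andP[u0 utau]] := Pstep j tau Dtau.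
have taues : tau \in es.
  suff : E tau by rewrite Ees.
  by exists j; rewrite /= ?j0 //; split=> //; rewrite /= in_itv.
have us : u < s by exact: lt_le_trans taus.
(* The epoch [tau] is counted at [s] but not at [u]. *)
have cu : (count (<= u) es < n)%N.
  apply: leq_trans (count_lt utau taues) _.
  rewrite -ltnS; apply: leq_ltn_trans ltn; apply: sub_count => x /=.
  by move=> /le_trans; apply.
have ut : 0 <= u <= t + 1 by rewrite u0 (ltW (lt_le_trans us st)).
by apply; apply: IH => //; lia.
Qed.

End evolution.

(** * Max-plus linearity and the variational formula *)

(** This says that [a] is the attained maximum of [h k - y k], phrased without subtracting a
    possibly infinite [y k]. *)
Definition is_max_diff (h : int -> int) (y : int -> \bar int) (a : int) :=
  (forall k, (h k - a)%:E <= y k)%E /\ exists k, y k = (h k - a)%:E.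

(** The reflection of a value [x] to [a - x] turns each term of the maximum in [z_rule] into the
    matching term of the minimum in [xi_rule], so the bounds pass through termwise. *)
Lemma xi_rule_max K l c r lz cz rz (a : int) :
  ((a - lz)%:E <= l -> (a - cz)%:E <= c -> (a - rz)%:E <= r ->
  (a - z_rule K lz cz rz)%:E <= xi_rule K l c r)%E.
Proof.
have step (p q d : int) x : p - d <= q -> (q%:E <= x -> p%:E <= x + d%:E)%E.
  by case: x => [x pq| |//]; rewrite ?leey // -EFinD !lee_fin; lia.
have step0 (p q : int) x : p <= q -> (q%:E <= x -> p%:E <= x)%E.
  by move=> pq; apply: le_trans; rewrite lee_fin.
rewrite /z_rule /xi_rule; case: K => [n|] hl hc hr; rewrite !le_min.
  rewrite (step0 _ _ _ _ hl) ?(step _ _ _ _ _ hc) ?(step _ _ _ _ _ hr) //; lia.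
by rewrite (step0 _ _ _ _ hl) ?(step _ _ _ _ _ hc) //; lia.
Qed.

(** The bound is [xi_rule_max] for each [k]. For attainment, the term that realizes the maximum in
    [z_rule] selects one of the three sites, and the maximizer of that site is reused. *)
Lemma is_max_diff_rule K h yl yc yr l c r :
  is_max_diff h yl l -> is_max_diff h yc c -> is_max_diff h yr r ->
  is_max_diff h (fun k => xi_rule K (yl k) (yc k) (yr k)) (z_rule K l c r).
Proof.
move=> [ul [kl el]] [uc [kc ec]] [ur [kr er]].
have lb k := xi_rule_max K (ul k) (uc k) (ur k); split=> //.
suff [k hk] : exists k,
    (xi_rule K (yl k) (yc k) (yr k) <= (h k - z_rule K l c r)%:E)%E.
  by exists k; apply/le_anti; rewrite hk lb.
have caseE : [\/ z_rule K l c r = c - 1, z_rule K l c r = l |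
    if K is Some n then z_rule K l c r = r - n%:Z else False].
  rewrite /z_rule; case: K {lb} => [n|]; last first.
    by case: leP => _; [apply: Or32|apply: Or31].
  by do ![case: leP => _]; do ?[exact: Or33|exact: Or32|exact: Or31].
case: caseE => [->|->|].
- exists kc; apply: (@le_trans _ _ (yc kc + 1%:E)%E).
    by rewrite /xi_rule; case: K {lb} => [n|]; rewrite !ge_min lexx.
  by rewrite ec -EFinD lee_fin; lia.
- exists kl; rewrite -el.
  by rewrite /xi_rule; case: K {lb} => [n|]; rewrite !ge_min lexx ?orbT.
case: K {lb} => [n ->|//].
exists kr; apply: (@le_trans _ _ (yr kr + n%:Z%:E)%E).
  by rewrite /xi_rule !ge_min lexx orbT.
by rewrite er -EFinD lee_fin; lia.
Qed.

Lemma admissible_nondecreasing K w : admissible K w ->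
  forall i j : int, i <= j -> w i <= w j.
Proof.
move=> adm i j ij; have -> : j = i + `|j - i|%N%:Z by lia.
elim: `|j - i|%N => [|m IH]; first by rewrite addr0.
have [+ _] := adm (i + m%:Z); rewrite -addrA -PoszD addn1 subr_ge0.
exact: le_trans.
Qed.

Lemma admissible_lipschitz n w : admissible (Some n) w ->
  forall i j : int, i <= j -> w j - w i <= n%:Z * (j - i).
Proof.
move=> adm i j ij; have -> : j = i + `|j - i|%N%:Z by lia.
elim: `|j - i|%N => [|m IH]; first by rewrite addr0; lia.
have [_] := adm (i + m%:Z); rewrite -addrA -PoszD addn1.
move: (w _) (w _) (w _) IH => a b c; nia.
Qed.

(** The maximizer is [k = i]; monotonicity gives the bound for [k <= i], and the Lipschitz bound or
    the infinite value gives it for [k > i]. *)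
Lemma is_max_diff_init K w i : admissible K w ->
  is_max_diff w (fun k => xi_init K (i - k)) (w i).
Proof.
move=> adm; split=> [k|]; last by exists i; rewrite !subrr /xi_init lexx.
rewrite /xi_init; have [ki|ik] := leP 0 (i - k).
  rewrite lee_fin subr_le0; apply: (admissible_nondecreasing adm); lia.
case: K adm => [n|] adm; last by rewrite leey.
have ik' : i <= k by lia.
by have := admissible_lipschitz adm ik'; rewrite lee_fin; lia.
Qed.

Lemma variational_formula (R : realType) K (D : int -> set R)
    (w : int -> R -> int) (xi : int -> int -> R -> \bar int) :
  jump_times D -> admissible K (fun i => w i 0) -> evolves D (z_rule K) w ->
  (forall k, auxiliary K D k (xi k)) -> forall i (t : R), 0 <= t ->
  is_max_diff (fun k => w k 0) (fun k => xi k (i - k) t) (w i t).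
Proof.
move=> hD adm hw hxi.
have hy k : evolves D (xi_rule K) (fun i => xi k (i - k)).
  by apply: evolves_shift; case: (hxi k).
apply: (evolution_ind hD) => [i|i s t s0 st Dst|i t Dit].
- have -> : (fun k => xi k (i - k) 0) = (fun k => xi_init K (i - k)).
    by apply/funext => k; case: (hxi k) => ->.
  exact: is_max_diff_init (fun i => w i 0) i adm.
- have -> : (fun k => xi k (i - k) t) = (fun k => xi k (i - k) s).
    by apply/funext => k; exact: (evolves_constant (hy k)).
  by rewrite (evolves_constant hw s0 st Dst).
have [u ut step] := evolves_step hD Dit.
exists u => // Pl Pc Pr.
(* The same [u] serves for all [k], so the three hypotheses at time [u] combine. *)
have -> : (fun k => xi k (i - k) t) = (fun k => xi_rule K
    (xi k (i - 1 - k) u) (xi k (i - k) u) (xi k (i + 1 - k) u)).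
  by apply/funext => k; exact: (step _ _ _ (hy k)).
by rewrite (step _ _ _ hw); exact: is_max_diff_rule Pl Pc Pr.
Qed.

(** * Attained extrema and the second class particle *)

Lemma eq_ereal_inf_int (R : realType) (S : set int) (m : int) :
  S m -> (forall i, S i -> m <= i) ->
  (m%:~R : R)%:E = ereal_inf [set ((i%:~R : R)%:E) | i in S].
Proof.
move=> Sm lem; apply/le_anti/andP; split.
  by apply: le_ereal_inf_tmp => _ [i Si <-]; rewrite lee_fin ler_int; exact: lem.
by apply: ereal_inf_lbound; exists m.
Qed.

Lemma eq_ereal_sup_int (R : realType) (S : set int) (m : int) :
  S m -> (forall i, S i -> i <= m) ->
  (m%:~R : R)%:E = ereal_sup [set ((i%:~R : R)%:E) | i in S].
Proof.
move=> Sm lem; apply/le_anti/andP; split.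
  by apply: ereal_sup_ubound; exists m.
by apply: ge_ereal_sup => _ [i Si <-]; rewrite lee_fin ler_int; exact: lem.
Qed.

(** The left-hand equation fails for infinite [x], so it already forces finiteness. *)
Lemma eq_EFin_sub (a b : int) (x : \bar int) :
  (a%:E = b%:E - x)%E <-> x = (b - a)%:E.
Proof.
case: x => [x| |] //=; rewrite -EFinB.
by split=> [[->]|[->]]; congr EFin; lia.
Qed.

Theorem proposition4p1 (R : realType) (K : option nat) (D : int -> set R)
    (z zt : int -> R -> int) (xi : int -> int -> R -> \bar int) (X : R -> int)
    (hD : jump_times D)
    (hz0 : admissible K (fun i => z i 0))
    (hz : evolves D (z_rule K) z)
    (hX0 : second_class_start K z (X 0))
    (hzt : evolves D (z_rule K) zt)
    (hX : forall t : R, 0 <= t -> second_class_position z zt t (X t))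
    (hxi : forall k, auxiliary K D k (xi k))
    (t : R) (ht : 0 <= t) :
  ((X t)%:~R : R)%:E =
    ereal_inf [set ((i%:~R : R)%:E) | i in
      [set i : int | exists k : int, X 0 <= k /\
         (z i t)%:E = ((z k 0%R)%:E - xi k (i - k)%R t)%E]] /\
  ((X t)%:~R : R)%:E =
    (1%:E + ereal_sup [set ((i%:~R : R)%:E) | i in
      [set i : int | exists k : int, (k < X 0)%R /\
         (zt i t)%:E = (zt k 0%R)%:E - xi k (i - k)%R t]])%E.
Proof.
have [zt0l zt0r] := hX 0 (lexx _).
(* Only the increment into site [X 0] changes, growing by 1; [second_class_start] leaves room for
   it. *)
have adm_zt : admissible K (fun i => zt i 0).
  move=> i; have [z0 zK] := hz0 i.
  have [iX|iX] := leP (i + 1) (X 0 - 1).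
    by rewrite !zt0l //; lia.
  have [iX'|iX'] := leP (X 0) i.
    by rewrite !zt0r //; [split; first lia; case: K zK {hz0 hz hX0 hzt hxi} => // n; lia|lia].
  have iE : i = X 0 - 1 by lia.
  rewrite zt0r ?zt0l; [|lia|lia]; split; first by lia.
  case: K hX0 {hz0 hz hzt hxi zK} => // n; rewrite /second_class_start /Defs.eta iE.
  by rewrite subrK; lia.
have z_max := variational_formula hD hz0 hz hxi.
have zt_max := variational_formula hD adm_zt hzt hxi.
have [ztl ztr] := hX t ht.
split.
  apply: eq_ereal_inf_int => [|i [k [kX /eq_EFin_sub e]]].
    (* A maximizer for [zt] at [X t] also works for [z] if [X 0 <= k], since both sides drop by 1.
       If [k < X 0], it would give [z] a value exceeding its maximum by 1. *)
    have [_ [k ek]] := zt_max (X t) t ht.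
    exists k; have [kX|kX] := leP (X 0) k.
      by split=> //; apply/eq_EFin_sub; rewrite ek zt0r // ztr //; congr EFin; lia.
    by have [/(_ k)] := z_max (X t) t ht; rewrite ek zt0l ?ztr // ?lee_fin; lia.
  (* For [i < X t], an index [k >= X 0] maximal for [z] would give the value [z i t + 1] for [zt],
     above its maximum [z i t]. *)
  rewrite leNgt; apply/negP => iX.
  have [/(_ k)] := zt_max i t ht; rewrite e zt0r // ztl ?lee_fin; lia.
have -> : X t = 1 + (X t - 1) by lia.
rewrite intrD EFinD; congr (_ + _)%E.
apply: eq_ereal_sup_int => [|i [k [kX /eq_EFin_sub e]]].
  (* The roles of [z] and [zt] are exchanged: at [X t - 1] the two agree, which excludes a maximizer
     [k >= X 0] for [z]. *)
  have [_ [k ek]] := z_max (X t - 1) t ht.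
  exists k; have [kX|kX] := leP (X 0) k.
    by have [/(_ k)] := zt_max (X t - 1) t ht; rewrite ek zt0r // ztl ?lee_fin; lia.
  by split=> //; apply/eq_EFin_sub; rewrite ek zt0l ?ztl //; lia.
rewrite leNgt; apply/negP => iX.
have [/(_ k)] := z_max i t ht; rewrite e zt0l ?ztr ?lee_fin; lia.
Qed.
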